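(* Assume that $g$ satisfies (H1), (H2) and (H3) of the context, and let \[ c^*:=\inf_{\lambda>0}\frac{D(e^{\lambda}+e^{-\lambda}-2)+g(0,0)}{\lambda}. \] Let $\varphi=(\varphi_n)_{n\in\mathbb{Z}}$ be an admissible initial datum such that there is some $M>0$ with $\varphi_n(s)=0$ for all $|n|>M$ and $s\in[-\tau,0]$, and such that $\varphi_n(0)>0$ for some $n\in\mathbb{Z}$. Let $u_n(t)$ be the solution of the initial value problem \[ \begin{cases} \dfrac{du_n(t)}{dt}=D\left(u_{n+1}(t)-2u_n(t)+u_{n-1}(t)\right)+u_n(t)\,g(u_n(t),u_n(t-\tau)), & n\in\mathbb{Z},\ t>0,\\ u_n(s)=\varphi_n(s), & n\in\mathbb{Z},\ s\in[-\tau,0]. \end{cases} \] Then $c^*$ is the spreading speed of $u_n(t)$.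
   Context: Constants: $D>0$ and a time delay $\tau\ge 0$ are fixed. The function $g:\mathbb{R}^2\to\mathbb{R}$ is subject to the assumptions: (H1) $g(1,0)=0$ and $g(u,0)>0$ for $u\in(0,1)$. (H2) $g(u,v)$ is Lipschitz continuous and strictly monotone decreasing (in $u$ and in $v$) for $u,v\in[0,1]$, and $g(u,0)\to-\infty$ as $u\to\infty$. (H3) $g(0,1)>0$, and there exists $E\in(0,1)$ such that $g(E,E)=0$. Admissible initial datum: $s\mapsto(\varphi_n(s))_{n\in\mathbb{Z}}$ is a map from $[-\tau,0]$ to $l^\infty$ (bounded sequences indexed by $\mathbb{Z}$) with $0\le\varphi_n(s)\le1$ for all $n\in\mathbb{Z}$, $s\in[-\tau,0]$, and for each $n\in\mathbb{Z}$ the function $\varphi_n$ is uniformly continuous on $[-\tau,0]$. Solution: let $d>0$ be a constant such that $u\mapsto du+ug(u,1)$ is monotone increasing on $[0,1]$. The solution of the initial value problem is the (unique) mild solution, i.e. $u_n(s)=\varphi_n(s)$ for $s\in[-\tau,0]$ and, for $t>0$, $u_n(t)=e^{-(2D+d)t}\varphi_n(0)+\int_0^t e^{-(2D+d)(t-s)}\left[du_n(s)+D(u_{n+1}(s)+u_{n-1}(s))+u_n(s)g(u_n(s),u_n(s-\tau))\right]ds$. Spreading speed: for a nonnegative function $u_n(t)$, $n\in\mathbb{Z}$, $t>0$, a number $c_1>0$ is the spreading speed of $u_n(t)$ if (1) for any $c>c_1$, $\lim_{t\to\infty}\sup_{|n|>ct}u_n(t)=0$; and (2) for any $0<c<c_1$,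 $\liminf_{t\to\infty}\inf_{|n|<ct}u_n(t)>0$.
   Formalization: The solution is taken to be a mild solution with values 0 ≤ u_n(t) ≤ 1 for all t > 0; since g is controlled only on [0,1]², mild solutions need not be unique or stay in [0,1] otherwise. *)

(* Defs.v *)
From Stdlib Require Import Reals ZArith Lra.
From Coquelicot Require Import Coquelicot.
Open Scope R_scope.

Definition H1 (g : R -> R -> R) : Prop :=
  g 1 0 = 0 /\ (forall u, 0 < u < 1 -> 0 < g u 0).

Definition H2 (g : R -> R -> R) : Prop :=
  (exists L : R, forall u1 v1 u2 v2 : R,
      0 <= u1 <= 1 -> 0 <= v1 <= 1 -> 0 <= u2 <= 1 -> 0 <= v2 <= 1 ->
      Rabs (g u1 v1 - g u2 v2) <= L * (Rabs (u1 - u2) + Rabs (v1 - v2))) /\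
  (forall u1 u2 v : R,
      0 <= u1 <= 1 -> 0 <= u2 <= 1 -> 0 <= v <= 1 -> u1 < u2 -> g u2 v < g u1 v) /\
  (forall u v1 v2 : R,
      0 <= u <= 1 -> 0 <= v1 <= 1 -> 0 <= v2 <= 1 -> v1 < v2 -> g u v2 < g u v1) /\
  is_lim (fun u => g u 0) p_infty m_infty.

Definition H3 (g : R -> R -> R) : Prop :=
  0 < g 0 1 /\ (exists E : R, 0 < E < 1 /\ g E E = 0).

(* The pointwise bounds put every slice n |-> phi n s in l^infty. *)
Definition admissible (tau : R) (phi : Z -> R -> R) : Prop :=
  (forall n s, - tau <= s <= 0 -> 0 <= phi n s <= 1) /\
  (forall n, uniform_continuity (phi n) (fun s => - tau <= s <= 0)).

Definition monotonizing (g : R -> R -> R) (d : R) : Prop :=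
  0 < d /\
  (forall u1 u2 : R, 0 <= u1 <= 1 -> 0 <= u2 <= 1 -> u1 <= u2 ->
      d * u1 + u1 * g u1 1 <= d * u2 + u2 * g u2 1).

Definition mild_integrand (D tau d : R) (g : R -> R -> R) (u : Z -> R -> R)
    (n : Z) (t s : R) : R :=
  exp (- (2 * D + d) * (t - s)) *
  (d * u n s + D * (u (n + 1)%Z s + u (n - 1)%Z s)
   + u n s * g (u n s) (u n (s - tau))).

(* Mild solutions are sought among the [0,1]-valued functions: g is only
   controlled on [0,1]^2, so neither uniqueness nor invariance of [0,1] can be
   expected in a larger class.  Continuity of u n on [0, +oo) is not asked for
   because it follows from the integral equation.  Values of u n before - tau
   are irrelevant. *)
Definition mild_solution (D tau d : R) (g : R -> R -> R)
    (phi u : Z -> R -> R) : Prop :=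
  (forall n t, 0 < t -> 0 <= u n t <= 1) /\
  (forall n s, - tau <= s <= 0 -> u n s = phi n s) /\
  (forall n t, 0 < t ->
      ex_RInt (mild_integrand D tau d g u n t) 0 t /\
      u n t = exp (- (2 * D + d) * t) * phi n 0%R
              + RInt (mild_integrand D tau d g u n t) 0 t).

(* The infimum is over a nonempty set of reals bounded below when D > 0 and
   g 0 0 > 0, so [real] only casts a finite value. *)
Definition c_star (D : R) (g : R -> R -> R) : R :=
  real (Glb_Rbar (fun y => exists lambda : R, 0 < lambda /\
    y = (D * (exp lambda + exp (- lambda) - 2) + g 0 0) / lambda)).

Definition outer_sup (u : Z -> R -> R) (c t : R) : Rbar :=
  Lub_Rbar (fun y => exists n : Z, c * t < Rabs (IZR n) /\ y = u n t).

Definition inner_inf (u : Z -> R -> R) (c t : R) : Rbar :=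
  Glb_Rbar (fun y => exists n : Z, Rabs (IZR n) < c * t /\ y = u n t).

(* Convergence, as t -> +oo, of an extended-real function to a finite limit:
   [is_lim] only applies to real functions, and [real] sends +-oo to 0, so
   finiteness for large t has to be required separately. *)
Definition tends_to (f : R -> Rbar) (l : R) : Prop :=
  Rbar_locally p_infty (fun t => is_finite (f t)) /\
  is_lim (fun t => real (f t)) p_infty l.

Definition liminf_infty (f : R -> Rbar) : Rbar :=
  Rbar_lub (fun m => exists T : R,
    m = Rbar_glb (fun y => exists t : R, T < t /\ y = f t)).

Definition is_spreading_speed (u : Z -> R -> R) (c1 : R) : Prop :=
  0 < c1 /\
  (forall c, c1 < c -> tends_to (outer_sup u c) 0) /\
  (forall c, 0 < c < c1 -> Rbar_lt 0 (liminf_infty (inner_inf u c))).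

(* Main.v *)
Require Import Defs.
From Stdlib Require Import Reals ZArith Lra Lia.
From Coquelicot Require Import Coquelicot.
Open Scope R_scope.

(** Write r = g(0,0) > 0 and Phi(l) = D (e^l + e^(-l) - 2) + r, so that the
    spreading speed is the infimum of Phi(l) / l over l > 0.

    Upper bound.  Since g <= r on the unit square, u is a subsolution of the
    linear equation w' = D (w_(n+1) - 2 w_n + w_(n-1)) + r w, which has the exact
    solutions K e^(- l n + Phi(l) t), l of either sign.  Comparison
    ([exponential_upper_bound]) gives u_n(t) <= K e^(- l |n| + Phi(l) t), and
    choosing l with Phi(l) < c l makes this exponentially small on |n| > c t.

    Lower bound.  The delay is removed first.  As u' >= - b u, the past value is
    controlled by the present one, u_n(t - tau) <= e^(b tau) u_n(t), so the
    Lipschitz bound g(a, b) >= r - L (a + b) turns u into a supersolution of the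
    undelayed logistic equation v' = D (v_(n+1) - 2 v_n + v_(n-1)) + v (r - A v)
    ([mild_solution_logistic_supersolution]).

    For the logistic equation, moving humps eps e^(- l x) cos(omega x),
    x = n - k t, |omega x| <= pi/2, are compactly supported subsolutions.  The
    sine part of the equation forces k omega = 2 D sinh(l) sin(omega), and the
    cosine part then requires 2 D (cosh(l) cos(omega) - 1) + r > k l, which
    for small omega is a perturbation of Phi(l) > k l.  The latter holds with a
    margin uniform in |k| <= c as soon as c is below the spreading speed
    ([wave_parameters]).  A first contact argument puts the hump below u
    ([hump_comparison]).  Every site with |n| <= c (t - T) is the centre at time t
    of the hump of speed n / (t - T), and all these humps have the same height
    eps, which is therefore a lower bound for u_n(t)
    ([logistic_supersolution_spreads]). *)

(** * The dispersion relation and the number c_star *)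

Definition dispersion (D r l : R) : R := D * (exp l + exp (- l) - 2) + r.

Lemma exp_le (x y : R) : x <= y -> exp x <= exp y.
Proof. intros [H | ->]; [left; now apply exp_increasing | apply Rle_refl]. Qed.

Lemma exp_sub_exp_opp_ge (l : R) : 0 <= l -> l <= exp l - exp (- l).
Proof.
  intros Hl.
  pose proof (exp_ineq1_le l).
  assert (exp (- l) <= 1) by (rewrite <- exp_0; apply exp_le; lra).
  lra.
Qed.

Lemma exp_add_exp_opp_ge (l : R) : 0 <= l -> l * l / 4 <= exp l + exp (- l) - 2.
Proof.
  intros Hl.
  pose proof (exp_sub_exp_opp_ge (l / 2) ltac:(lra)) as H.
  replace (exp l) with (exp (l / 2) * exp (l / 2)) by (rewrite <- exp_plus; f_equal; field).
  replace (exp (- l)) with (exp (- (l / 2)) * exp (- (l / 2)))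
    by (rewrite <- exp_plus; f_equal; field).
  assert (exp (l / 2) * exp (- (l / 2)) = 1)
    by (rewrite <- exp_plus, Rplus_opp_r; apply exp_0).
  nra.
Qed.

Lemma dispersion_opp (D r l : R) : dispersion D r (- l) = dispersion D r l.
Proof. unfold dispersion. rewrite Ropp_involutive. ring. Qed.

Lemma dispersion_ge (D r l : R) : 0 < D -> 0 <= l -> r <= dispersion D r l.
Proof.
  intros HD Hl. unfold dispersion.
  pose proof (exp_add_exp_opp_ge l Hl). nra.
Qed.

(** Since e^l + e^(-l) - 2 >= l^2 / 4, this is the inequality between the
    arithmetic and geometric means of D l^2 / 4 and r.  It makes the infimum that
    defines the speed finite and positive. *)
Lemma dispersion_linear_lower_bound (D r l : R) :
  0 < D -> 0 < r -> 0 < l -> sqrt (D * r) * l <= dispersion D r l.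
Proof.
  intros HD Hr Hl. unfold dispersion.
  pose proof (exp_add_exp_opp_ge l ltac:(lra)) as H.
  assert (Hs : sqrt (D * r) * sqrt (D * r) = D * r) by (apply sqrt_sqrt; nra).
  assert (D * (sqrt (D * r) * l) <= D * (D * (l * l / 4) + r)).
  { pose proof (Rle_0_sqr (D * l / 2 - sqrt (D * r))) as Hq. unfold Rsqr in Hq. nra. }
  assert (sqrt (D * r) * l <= D * (l * l / 4) + r) by (apply Rmult_le_reg_l with D; lra).
  nra.
Qed.

Lemma c_star_is_glb (D : R) (g : R -> R -> R) :
  0 < D -> 0 < g 0 0 ->
  is_glb_Rbar (fun y => exists l, 0 < l /\ y = dispersion D (g 0 0) l / l) (Finite (c_star D g)).
Proof.
  intros HD Hr. unfold c_star, dispersion.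
  set (E := fun y => exists lambda : R, 0 < lambda /\
    y = (D * (exp lambda + exp (- lambda) - 2) + g 0 0) / lambda).
  pose proof (Glb_Rbar_correct E) as [Hlb Hglb].
  assert (Hfin : is_finite (Glb_Rbar E)).
  { apply is_finite_correct. destruct (Glb_Rbar E) as [x | |] eqn:Heq.
    - now exists x.
    - exfalso. specialize (Hlb _ (ex_intro _ 1 (conj Rlt_0_1 eq_refl))). exact Hlb.
    - exfalso. refine (Hglb (Finite (sqrt (D * g 0 0))) _).
      intros y [l [Hl ->]]. simpl.
      apply Rle_div_r; [exact Hl|]. now apply dispersion_linear_lower_bound. }
  rewrite Hfin. split; assumption.
Qed.

Lemma c_star_le_dispersion (D : R) (g : R -> R -> R) (l : R) :
  0 < D -> 0 < g 0 0 -> 0 < l -> c_star D g * l <= dispersion D (g 0 0) l.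
Proof.
  intros HD Hr Hl. destruct (c_star_is_glb D g HD Hr) as [Hlb _].
  apply Rle_div_r; [exact Hl|].
  exact (Hlb _ (ex_intro _ l (conj Hl eq_refl))).
Qed.

Lemma c_star_pos (D : R) (g : R -> R -> R) : 0 < D -> 0 < g 0 0 -> 0 < c_star D g.
Proof.
  intros HD Hr. destruct (c_star_is_glb D g HD Hr) as [_ Hglb].
  apply Rlt_le_trans with (sqrt (D * g 0 0)); [apply sqrt_lt_R0; nra|].
  apply (Hglb (Finite (sqrt (D * g 0 0)))).
  intros y [l [Hl ->]]. simpl. apply Rle_div_r; [exact Hl|].
  now apply dispersion_linear_lower_bound.
Qed.

Lemma c_star_lt_dispersion (D : R) (g : R -> R -> R) (c : R) :
  0 < D -> 0 < g 0 0 -> c_star D g < c ->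
  exists l, 0 < l /\ dispersion D (g 0 0) l < c * l.
Proof.
  intros HD Hr Hc. destruct (c_star_is_glb D g HD Hr) as [_ Hglb].
  apply Classical_Prop.NNPP. intros Hno.
  apply (Rlt_not_le _ _ Hc).
  apply (Hglb (Finite c)). intros y [l [Hl ->]]. simpl.
  apply Rle_div_r; [exact Hl|].
  apply Rnot_lt_le. intros Hlt. apply Hno. now exists l.
Qed.

(** * Consequences of the hypotheses on g *)

Lemma g00_pos (g : R -> R -> R) : H1 g -> H2 g -> 0 < g 0 0.
Proof.
  intros [_ Hp] [_ [Hm _]].
  apply Rlt_trans with (g (1 / 2) 0); [apply Hp; lra | apply Hm; lra].
Qed.

Lemma g_le_g00 (g : R -> R -> R) (a b : R) :
  H2 g -> 0 <= a <= 1 -> 0 <= b <= 1 -> g a b <= g 0 0.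
Proof.
  intros [_ [Hm [Hm' _]]] Ha Hb.
  apply Rle_trans with (g a 0).
  - destruct (Req_dec b 0) as [-> | Hb0]; [lra|]. left. apply Hm'; lra.
  - destruct (Req_dec a 0) as [-> | Ha0]; [lra|]. left. apply Hm; lra.
Qed.

Lemma g_lipschitz_nonneg (g : R -> R -> R) :
  H2 g -> exists L, 0 <= L /\ forall u1 v1 u2 v2,
      0 <= u1 <= 1 -> 0 <= v1 <= 1 -> 0 <= u2 <= 1 -> 0 <= v2 <= 1 ->
      Rabs (g u1 v1 - g u2 v2) <= L * (Rabs (u1 - u2) + Rabs (v1 - v2)).
Proof.
  intros [[L HL] _]. exists (Rabs L). split; [apply Rabs_pos|].
  intros u1 v1 u2 v2 Hu1 Hv1 Hu2 Hv2.
  eapply Rle_trans; [apply HL; assumption|].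
  apply Rmult_le_compat_r; [|apply Rle_abs].
  pose proof (Rabs_pos (u1 - u2)). pose proof (Rabs_pos (v1 - v2)). lra.
Qed.

(** * The upper bound *)

(** e^(m t) solves y' = - a y + (a + m) e^(m t): exponentials are reproduced
    exactly by the mild formulation, which keeps all the integrals of the
    comparison below explicit. *)
Lemma is_RInt_exp_convolution (a m t : R) :
  is_RInt (fun s => exp (- a * (t - s)) * ((a + m) * exp (m * s))) 0 t
    (exp (m * t) - exp (- a * t)).
Proof.
  replace (exp (m * t) - exp (- a * t))
    with (minus (exp (- a * (t - t)) * exp (m * t)) (exp (- a * (t - 0)) * exp (m * 0))).
  - apply (is_RInt_derive (fun s => exp (- a * (t - s)) * exp (m * s))).
    + intros s _. auto_derive; [easy|]. unfold Rminus. ring.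
    + intros s _. apply (@ex_derive_continuous R_AbsRing R_NormedModule). auto_derive. easy.
  - unfold minus, plus, opp; simpl.
    replace (- a * (t - t)) with 0 by ring. replace (m * 0) with 0 by ring.
    rewrite exp_0. replace (- a * (t - 0)) with (- a * t) by ring. ring.
Qed.

Lemma mild_solution_range (D tau d : R) g phi u (n : Z) (t : R) :
  admissible tau phi -> mild_solution D tau d g phi u -> - tau <= t -> 0 <= u n t <= 1.
Proof.
  intros [Hphi _] [Hu [Hi _]] Ht.
  destruct (Rlt_le_dec 0 t) as [H | H]; [now apply Hu|].
  rewrite Hi by lra. apply Hphi. lra.
Qed.

(** Sites are infinitely many, so no first contact argument is available.
    Instead, u <= w + B e^(m t) is fed back into the mild equation: the exact
    solution w reproduces itself, and m is such that the error term comes back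
    halved.  Starting from u <= 1 and iterating kills the error. *)
Lemma exponential_upper_bound (D tau d : R) g phi u (M l : R) :
  0 < D -> 0 <= tau -> 0 < d -> H1 g -> H2 g -> admissible tau phi ->
  mild_solution D tau d g phi u ->
  (forall n s, M < Rabs (IZR n) -> - tau <= s <= 0 -> phi n s = 0) ->
  forall n t, 0 <= t ->
  u n t <= exp (Rabs l * M) * exp (- l * IZR n) * exp (dispersion D (g 0 0) l * t).
Proof.
  intros HD Htau Hd Hg1 Hg2 Hphi Hu Hsupp.
  pose proof (g00_pos g Hg1 Hg2) as Hr. set (r := g 0 0) in *.
  set (F := dispersion D r l).
  set (w := fun (n : Z) t => exp (Rabs l * M) * exp (- l * IZR n) * exp (F * t)).
  change (forall n t, 0 <= t -> u n t <= w n t).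
  assert (Hw : forall n t, 0 < w n t)
    by (intros; unfold w; repeat apply Rmult_lt_0_compat; apply exp_pos).
  assert (Hwn : forall n t, d * w n t + D * (w (n + 1)%Z t + w (n - 1)%Z t) + r * w n t
                            = (2 * D + d + F) * w n t).
  { intros n t. unfold w. rewrite plus_IZR, minus_IZR.
    replace (- l * (IZR n + 1)) with (- l * IZR n + - l) by ring.
    replace (- l * (IZR n - 1)) with (- l * IZR n + l) by ring.
    rewrite !exp_plus. unfold F, dispersion. ring. }
  assert (Hinit : forall n, phi n 0 <= w n 0).
  { intros n. destruct (Rlt_le_dec M (Rabs (IZR n))) as [Hn | Hn].
    - rewrite Hsupp by lra. left. apply Hw.
    - apply Rle_trans with 1; [apply Hphi; lra|].
      unfold w. rewrite Rmult_0_r, exp_0, Rmult_1_r, <- exp_plus.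
      rewrite <- exp_0. apply exp_le.
      assert (l * IZR n <= Rabs l * M).
      { eapply Rle_trans; [apply Rle_abs|]. rewrite Rabs_mult.
        apply Rmult_le_compat_l; [apply Rabs_pos | exact Hn]. }
      lra. }
  (* The error enters the integrand with the weight 2 D + d + r, which is half
     of (2 D + d) + m. *)
  set (m := d + 2 * D + 2 * r).
  assert (Himp : forall B, 0 <= B ->
    (forall n t, 0 <= t -> u n t <= w n t + B * exp (m * t)) ->
    (forall n t, 0 <= t -> u n t <= w n t + B / 2 * exp (m * t))).
  { intros B HB Hle n t [Ht | <-].
    2: { rewrite Rmult_0_r, exp_0. destruct Hu as [_ [Hi _]]. rewrite Hi by lra.
         pose proof (Hinit n). lra. }
    destruct (proj2 (proj2 Hu) n t Ht) as [Hex ->].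
    set (a := 2 * D + d).
    assert (Hint : is_RInt (fun s => exp (- a * (t - s)) *
        ((a + F) * w n s + B / 2 * ((a + m) * exp (m * s)))) 0 t
        (w n 0 * (exp (F * t) - exp (- a * t)) + B / 2 * (exp (m * t) - exp (- a * t)))).
    { eapply is_RInt_ext.
      2: { apply (@is_RInt_plus R_NormedModule).
           - exact (is_RInt_scal _ _ _ (w n 0) _ (is_RInt_exp_convolution a F t)).
           - exact (is_RInt_scal _ _ _ (B / 2) _ (is_RInt_exp_convolution a m t)). }
      intros s _. unfold scal, plus; simpl. unfold mult; simpl. unfold w.
      rewrite Rmult_0_r, exp_0. ring. }
    assert (RInt (mild_integrand D tau d g u n t) 0 t <=
        w n 0 * (exp (F * t) - exp (- a * t)) + B / 2 * (exp (m * t) - exp (- a * t))).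
    { apply (is_RInt_le (mild_integrand D tau d g u n t) (fun s => exp (- a * (t - s)) *
        ((a + F) * w n s + B / 2 * ((a + m) * exp (m * s)))) 0 t); [lra | | exact Hint |].
      - apply (@RInt_correct R_CompleteNormedModule). exact Hex.
      - intros s Hs. unfold mild_integrand, a. apply Rmult_le_compat_l; [left; apply exp_pos|].
        rewrite <- Hwn.
        assert (Hrange : forall k x, - tau <= x -> 0 <= u k x <= 1)
          by (intros; eapply mild_solution_range; eassumption).
        assert (u n s * g (u n s) (u n (s - tau)) <= r * u n s).
        { rewrite Rmult_comm. apply Rmult_le_compat_r; [apply Hrange; lra|].
          apply g_le_g00; try assumption; apply Hrange; lra. }
        pose proof (Hle n s ltac:(lra)). pose proof (Hle (n + 1)%Z s ltac:(lra)).
        pose proof (Hle (n - 1)%Z s ltac:(lra)).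
        set (e := B * exp (m * s)) in *.
        replace (B / 2 * ((2 * D + d + m) * exp (m * s))) with ((2 * D + d + r) * e)
          by (unfold e, m; field).
        assert ((d + r) * u n s <= (d + r) * (w n s + e)) by (apply Rmult_le_compat_l; lra).
        assert (D * (u (n + 1)%Z s + u (n - 1)%Z s) <= D * (w (n + 1)%Z s + e + (w (n - 1)%Z s + e)))
          by (apply Rmult_le_compat_l; lra).
        lra. }
    assert (Hwt : w n t = w n 0 * exp (F * t)).
    { unfold w. rewrite Rmult_0_r, exp_0. ring. }
    pose proof (Hinit n). pose proof (exp_pos (- a * t)).
    assert (exp (- a * t) * phi n 0 <= exp (- a * t) * w n 0) by (apply Rmult_le_compat_l; lra).
    assert (0 <= B / 2 * exp (- a * t)) by (apply Rmult_le_pos; lra).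
    fold a. rewrite Hwt. lra. }
  assert (Hall : forall k n t, 0 <= t -> u n t <= w n t + (/ 2) ^ k * exp (m * t)).
  { induction k as [| k IH].
    - intros n t Ht. simpl.
      assert (u n t <= 1) by (eapply mild_solution_range; try eassumption; lra).
      assert (1 <= exp (m * t)).
      { rewrite <- exp_0. apply exp_le. apply Rmult_le_pos; unfold m; lra. }
      pose proof (Hw n t). lra.
    - replace ((/ 2) ^ S k) with ((/ 2) ^ k / 2) by (simpl; field).
      apply Himp; [apply pow_le; lra | exact IH]. }
  intros n t Ht. apply le_epsilon. intros e He.
  destruct (pow_lt_1_zero (/ 2) ltac:(rewrite Rabs_pos_eq; lra) (e / exp (m * t))
    ltac:(apply Rdiv_lt_0_compat; [lra | apply exp_pos])) as [N HN].
  specialize (HN N (le_n _)). specialize (Hall N n t Ht).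
  rewrite Rabs_pos_eq in HN by (apply pow_le; lra).
  apply Rlt_div_r in HN; [lra | apply exp_pos].
Qed.

(** * Regularity of mild solutions *)

Definition source (D tau d : R) (g : R -> R -> R) (u : Z -> R -> R) (n : Z) (s : R) : R :=
  d * u n s + D * (u (n + 1)%Z s + u (n - 1)%Z s) + u n s * g (u n s) (u n (s - tau)).

Lemma mild_solution_integral (D tau d : R) g phi u (n : Z) (t : R) :
  mild_solution D tau d g phi u -> 0 < t ->
  is_RInt (fun s => exp ((2 * D + d) * s) * source D tau d g u n s) 0 t
    (exp ((2 * D + d) * t) * u n t - phi n 0).
Proof.
  intros [_ [_ Hu]] Ht. destruct (Hu n t Ht) as [Hex Heq].
  set (a := 2 * D + d) in *.
  pose proof (is_RInt_scal _ _ _ (exp (a * t)) _ (RInt_correct (V := R_CompleteNormedModule) _ _ _ Hex)) as H.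
  assert (He : exp (a * t) * exp (- a * t) = 1)
    by (rewrite <- exp_plus; replace (a * t + - a * t) with 0 by ring; apply exp_0).
  replace (exp (a * t) * u n t - phi n 0)
    with (scal (exp (a * t)) (RInt (mild_integrand D tau d g u n t) 0 t)).
  - revert H. apply is_RInt_ext. intros s _.
    unfold mild_integrand, scal; simpl. unfold mult; simpl. fold a.
    rewrite <- Rmult_assoc, <- exp_plus.
    replace (a * t + - a * (t - s)) with (a * s) by ring. reflexivity.
  - unfold scal; simpl. unfold mult; simpl. rewrite Heq.
    rewrite Rmult_plus_distr_l, <- Rmult_assoc, He. ring.
Qed.

Lemma mild_solution_continuous (D tau d : R) g phi u (n : Z) (t : R) :
  mild_solution D tau d g phi u -> 0 < t -> continuous (u n) t.
Proof.
  intros Hu Ht. set (a := 2 * D + d).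
  set (I := fun t => exp (a * t) * u n t - phi n 0).
  assert (HI : continuous I t).
  { apply (continuous_RInt_1 (fun s => exp (a * s) * source D tau d g u n s) 0 t I).
    apply (filter_imp (fun z => 0 < z)); [|now apply open_gt].
    intros z Hz. now apply mild_solution_integral. }
  assert (He : forall s : R, exp (- a * s) * (I s + phi n 0) = u n s).
  { intros s. unfold I.
    replace (exp (a * s) * u n s - phi n 0 + phi n 0) with (exp (a * s) * u n s) by ring.
    rewrite <- Rmult_assoc, <- exp_plus. replace (- a * s + a * s) with 0 by ring.
    rewrite exp_0. ring. }
  apply (continuous_ext _ _ _ He).
  apply (@continuous_mult R_UniformSpace R_AbsRing).
  - apply (@ex_derive_continuous R_AbsRing R_NormedModule). auto_derive. easy.
  - apply (@continuous_plus R_UniformSpace R_AbsRing R_NormedModule); [exact HI | apply continuous_const].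
Qed.

Lemma continuous_lipschitz_square (g : R -> R -> R) (L : R) (f h : R -> R) (t : R) :
  (forall u1 v1 u2 v2,
      0 <= u1 <= 1 -> 0 <= v1 <= 1 -> 0 <= u2 <= 1 -> 0 <= v2 <= 1 ->
      Rabs (g u1 v1 - g u2 v2) <= L * (Rabs (u1 - u2) + Rabs (v1 - v2))) ->
  0 <= L ->
  locally t (fun s => 0 <= f s <= 1) -> locally t (fun s => 0 <= h s <= 1) ->
  continuous f t -> continuous h t -> continuous (fun s => g (f s) (h s)) t.
Proof.
  intros Hg HL Hf Hh Cf Ch.
  apply filterlim_locally. intros eps.
  set (e := eps / (2 * (L + 1))).
  assert (He : 0 < e) by (apply Rdiv_lt_0_compat; [apply cond_pos | lra]).
  pose proof (proj1 (filterlim_locally f (f t)) Cf (mkposreal e He)) as Bf.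
  pose proof (proj1 (filterlim_locally h (h t)) Ch (mkposreal e He)) as Bh.
  pose proof (locally_singleton _ _ Hf) as Hft. pose proof (locally_singleton _ _ Hh) as Hht.
  generalize (filter_and _ _ (filter_and _ _ Hf Hh) (filter_and _ _ Bf Bh)).
  apply filter_imp. intros s [[Hfs Hhs] [Bfs Bhs]].
  change (Rabs (f s - f t) < e) in Bfs. change (Rabs (h s - h t) < e) in Bhs.
  change (Rabs (g (f s) (h s) - g (f t) (h t)) < eps).
  eapply Rle_lt_trans; [apply Hg; assumption|].
  apply Rle_lt_trans with (L * (2 * e)); [apply Rmult_le_compat_l; lra|].
  replace (pos eps) with ((L + 1) * (2 * e)) by (unfold e; field; lra).
  apply Rmult_lt_compat_r; lra.
Qed.

(** The equation holds classically only from time tau on: then t - tau is a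
    positive time, where u is continuous. *)
Lemma mild_solution_ode (D tau d : R) g phi u (n : Z) (t : R) :
  0 <= tau -> H2 g -> admissible tau phi ->
  mild_solution D tau d g phi u -> tau < t ->
  is_derive (u n) t
    (D * (u (n + 1)%Z t - 2 * u n t + u (n - 1)%Z t) + u n t * g (u n t) (u n (t - tau))).
Proof.
  intros Htau Hg Hphi Hu Ht. set (a := 2 * D + d).
  assert (Hrange : forall k x, - tau <= x -> 0 <= u k x <= 1)
    by (intros; eapply mild_solution_range; eassumption).
  assert (Hc : forall k, continuous (u k) t)
    by (intros k; eapply mild_solution_continuous; [eassumption | lra]).
  destruct (g_lipschitz_nonneg g Hg) as [L [HL HgL]].
  set (I := fun t => exp (a * t) * u n t - phi n 0).
  assert (HI : is_derive I t (exp (a * t) * source D tau d g u n t)).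
  { apply (is_derive_RInt (fun s => exp (a * s) * source D tau d g u n s) I 0 t).
    - apply (filter_imp (fun z => 0 < z)); [|apply open_gt; lra].
      intros z Hz. now apply mild_solution_integral.
    - unfold source.
      apply (@continuous_mult R_UniformSpace R_AbsRing).
      { apply (@ex_derive_continuous R_AbsRing R_NormedModule). auto_derive. easy. }
      apply (@continuous_plus R_UniformSpace R_AbsRing R_NormedModule).
      { apply (@continuous_plus R_UniformSpace R_AbsRing R_NormedModule).
        - apply (@continuous_mult R_UniformSpace R_AbsRing); [apply continuous_const | apply Hc].
        - apply (@continuous_mult R_UniformSpace R_AbsRing); [apply continuous_const|].
          apply (@continuous_plus R_UniformSpace R_AbsRing R_NormedModule); apply Hc. }
      apply (@continuous_mult R_UniformSpace R_AbsRing); [apply Hc|].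
      apply (continuous_lipschitz_square g L); try assumption.
      + apply (filter_imp (fun z => tau < z)); [|now apply open_gt].
        intros z Hz. apply Hrange. lra.
      + apply (filter_imp (fun z => tau < z)); [|now apply open_gt].
        intros z Hz. apply Hrange. lra.
      + apply Hc.
      + apply (continuous_comp (fun s => s - tau) (u n)).
        * apply (@ex_derive_continuous R_AbsRing R_NormedModule). auto_derive. easy.
        * eapply mild_solution_continuous; [eassumption | simpl; lra]. }
  assert (He : forall s, exp (- a * s) * exp (a * s) = 1).
  { intros s. rewrite <- exp_plus. replace (- a * s + a * s) with 0 by ring. apply exp_0. }
  assert (Hu' : forall s : R, exp (- a * s) * (I s + phi n 0) = u n s).
  { intros s. unfold I.
    replace (exp (a * s) * u n s - phi n 0 + phi n 0) with (exp (a * s) * u n s) by ring.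
    rewrite <- Rmult_assoc, He. ring. }
  apply (is_derive_ext _ _ _ _ Hu').
  auto_derive; [exists (exp (a * t) * source D tau d g u n t); exact HI|].
  replace (Derive (fun x : R => I x) t) with (exp (a * t) * source D tau d g u n t)
    by (symmetry; apply is_derive_unique; exact HI).
  transitivity (exp (- a * t) * exp (a * t) * (source D tau d g u n t - a * u n t)).
  { unfold I. ring. }
  rewrite He. unfold source, a. ring.
Qed.

(** * Removal of the delay *)

Definition logistic_supersolution (D r A T : R) (v : Z -> R -> R) : Prop :=
  forall n t, T <= t -> exists v', is_derive (v n) t v' /\
    D * (v (n + 1)%Z t - 2 * v n t + v (n - 1)%Z t) + v n t * (r - A * v n t) <= v'.

Lemma exp_weighted_mean_value (f f' : R -> R) (b x y : R) :
  x <= y -> (forall t, x <= t <= y -> is_derive f t (f' t)) ->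
  exists z, x <= z <= y /\
    f y - exp (- b * (y - x)) * f x = exp (b * (z - y)) * (f' z + b * f z) * (y - x).
Proof.
  intros Hxy Hf.
  destruct (MVT_gen (fun t => exp (b * (t - y)) * f t) x y
    (fun t => exp (b * (t - y)) * (f' t + b * f t))) as [z [Hz Heq]].
  - intros t Ht. rewrite Rmin_left, Rmax_right in Ht by exact Hxy.
    specialize (Hf t ltac:(lra)).
    auto_derive; [now exists (f' t)|].
    replace (Derive (fun x : R => f x) t) with (f' t)
      by (symmetry; apply is_derive_unique; exact Hf).
    unfold Rminus. ring.
  - intros t Ht. rewrite Rmin_left, Rmax_right in Ht by exact Hxy.
    specialize (Hf t ltac:(lra)).
    apply continuity_pt_filterlim.
    apply (@ex_derive_continuous R_AbsRing R_NormedModule (fun t => exp (b * (t - y)) * f t)).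
    auto_derive. now exists (f' t).
  - rewrite Rmin_left, Rmax_right in Hz by exact Hxy.
    exists z. split; [exact Hz|]. rewrite <- Heq.
    replace (b * (y - y)) with 0 by ring. rewrite exp_0.
    replace (- b * (y - x)) with (b * (x - y)) by ring. ring.
Qed.

(** The monotonizing constant makes d u + u g(u, v) nonnegative, so the integral
    term of the mild equation can only help. *)
Lemma mild_solution_decay (D tau d : R) g phi u (n : Z) (t : R) :
  0 <= tau -> H2 g -> monotonizing g d -> 0 < D -> admissible tau phi ->
  mild_solution D tau d g phi u -> 0 < t ->
  exp (- (2 * D + d) * t) * phi n 0 <= u n t.
Proof.
  intros Htau Hg [Hd Hmon] HD Hphi Hu Ht.
  assert (Hrange : forall k x, - tau <= x -> 0 <= u k x <= 1)
    by (intros; eapply mild_solution_range; eassumption).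
  destruct (proj2 (proj2 Hu) n t Ht) as [Hex ->].
  assert (0 <= RInt (mild_integrand D tau d g u n t) 0 t); [|lra].
  apply RInt_ge_0; [lra | exact Hex |]. intros s Hs.
  unfold mild_integrand. apply Rmult_le_pos; [left; apply exp_pos|].
  pose proof (Hrange n s ltac:(lra)) as Hus.
  pose proof (Hrange n (s - tau) ltac:(lra)) as Hud.
  pose proof (Hrange (n + 1)%Z s ltac:(lra)). pose proof (Hrange (n - 1)%Z s ltac:(lra)).
  pose proof (Hmon 0 (u n s) ltac:(lra) Hus ltac:(lra)).
  assert (g (u n s) 1 <= g (u n s) (u n (s - tau))).
  { destruct Hg as [_ [_ [Hg _]]].
    destruct (Req_dec (u n (s - tau)) 1) as [-> | Hne]; [lra|]. left. apply Hg; lra. }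
  assert (u n s * g (u n s) 1 <= u n s * g (u n s) (u n (s - tau)))
    by (apply Rmult_le_compat_l; lra).
  assert (0 <= D * (u (n + 1)%Z s + u (n - 1)%Z s)) by (apply Rmult_le_pos; lra).
  lra.
Qed.

Lemma reaction_lower_bound (g : R -> R -> R) (L : R) :
  (forall u1 v1 u2 v2,
      0 <= u1 <= 1 -> 0 <= v1 <= 1 -> 0 <= u2 <= 1 -> 0 <= v2 <= 1 ->
      Rabs (g u1 v1 - g u2 v2) <= L * (Rabs (u1 - u2) + Rabs (v1 - v2))) ->
  forall a b, 0 <= a <= 1 -> 0 <= b <= 1 -> g 0 0 - L * (a + b) <= g a b.
Proof.
  intros Hg a b Ha Hb. specialize (Hg a b 0 0 Ha Hb ltac:(lra) ltac:(lra)).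
  rewrite !Rminus_0_r, (Rabs_pos_eq a), (Rabs_pos_eq b) in Hg by lra.
  apply Rabs_le_between in Hg. lra.
Qed.

(** Because g is bounded below on the unit square, u_n' + b u_n is at least the
    inflow D (u_(n+1) + u_(n-1)).  Dropping the inflow bounds past values by
    present ones; keeping it carries positivity over to the neighbouring
    sites. *)
Lemma mild_solution_mean_growth (D tau d : R) g phi u :
  0 < D -> 0 <= tau -> H1 g -> H2 g -> admissible tau phi ->
  mild_solution D tau d g phi u ->
  exists b, 0 <= b /\ forall n x y, tau < x -> x <= y ->
    exists z, x <= z <= y /\
    exp (- b * (y - x)) * u n x
      + exp (b * (z - y)) * (D * (u (n + 1)%Z z + u (n - 1)%Z z)) * (y - x) <= u n y.
Proof.
  intros HD Htau Hg1 Hg2 Hphi Hu.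
  assert (Hrange : forall k x, - tau <= x -> 0 <= u k x <= 1)
    by (intros; eapply mild_solution_range; eassumption).
  destruct (g_lipschitz_nonneg g Hg2) as [L [HL HgL]].
  pose proof (g00_pos g Hg1 Hg2) as Hr.
  exists (2 * D + 2 * L). split; [lra|]. intros n x y Hx Hxy.
  destruct (exp_weighted_mean_value (u n) (fun t =>
    D * (u (n + 1)%Z t - 2 * u n t + u (n - 1)%Z t) + u n t * g (u n t) (u n (t - tau)))
    (2 * D + 2 * L) x y Hxy) as [z [Hz Heq]].
  { intros t Ht. eapply mild_solution_ode; try eassumption. lra. }
  exists z. split; [exact Hz|].
  enough (exp ((2 * D + 2 * L) * (z - y)) * (D * (u (n + 1)%Z z + u (n - 1)%Z z)) * (y - x)
    <= u n y - exp (- (2 * D + 2 * L) * (y - x)) * u n x) by lra.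
  rewrite Heq. apply Rmult_le_compat_r; [lra|].
  apply Rmult_le_compat_l; [left; apply exp_pos|].
  pose proof (Hrange n z ltac:(lra)) as Hun. pose proof (Hrange n (z - tau) ltac:(lra)) as Hud.
  pose proof (reaction_lower_bound g L HgL _ _ Hun Hud).
  assert (L * (u n z + u n (z - tau)) <= L * 2) by (apply Rmult_le_compat_l; lra).
  assert (u n z * (- (2 * L)) <= u n z * g (u n z) (u n (z - tau)))
    by (apply Rmult_le_compat_l; lra).
  lra.
Qed.

Lemma mild_solution_pos (D tau d : R) g phi u :
  0 < D -> 0 <= tau -> H1 g -> H2 g -> monotonizing g d -> admissible tau phi ->
  mild_solution D tau d g phi u -> (exists n, 0 < phi n 0) ->
  forall n t, tau < t -> 0 < u n t.
Proof.
  intros HD Htau Hg1 Hg2 Hd Hphi Hu [n0 Hn0].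
  assert (Hrange : forall k x, - tau <= x -> 0 <= u k x <= 1)
    by (intros; eapply mild_solution_range; eassumption).
  destruct (mild_solution_mean_growth D tau d g phi u HD Htau Hg1 Hg2 Hphi Hu) as [b [_ Hb]].
  assert (Hspread : forall n, (forall t, tau < t -> 0 < u (n + 1)%Z t + u (n - 1)%Z t) ->
    forall t, tau < t -> 0 < u n t).
  { intros n Hn t Ht.
    destruct (Hb n ((tau + t) / 2) t ltac:(lra) ltac:(lra)) as [z [Hz Hle]].
    eapply Rlt_le_trans; [|exact Hle].
    apply Rplus_le_lt_0_compat.
    - apply Rmult_le_pos; [left; apply exp_pos | apply Hrange; lra].
    - repeat apply Rmult_lt_0_compat; [apply exp_pos | exact HD | apply Hn; lra | lra]. }
  assert (Hk : forall k : nat, forall t, tau < t ->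
    0 < u (n0 + Z.of_nat k)%Z t /\ 0 < u (n0 - Z.of_nat k)%Z t).
  { induction k as [| k IH]; intros t Ht.
    - rewrite Z.add_0_r, Z.sub_0_r.
      assert (0 < u n0 t); [|easy].
      eapply Rlt_le_trans; [|apply (mild_solution_decay D tau d g phi u n0 t); try assumption; lra].
      apply Rmult_lt_0_compat; [apply exp_pos | exact Hn0].
    - split; apply Hspread; try exact Ht; intros s Hs; destruct (IH s Hs) as [IHr IHl].
      + replace (n0 + Z.of_nat (S k) - 1)%Z with (n0 + Z.of_nat k)%Z by lia.
        pose proof (Hrange (n0 + Z.of_nat (S k) + 1)%Z s ltac:(lra)). lra.
      + replace (n0 - Z.of_nat (S k) + 1)%Z with (n0 - Z.of_nat k)%Z by lia.
        pose proof (Hrange (n0 - Z.of_nat (S k) - 1)%Z s ltac:(lra)). lra. }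
  intros n t Ht. destruct (Z_le_gt_dec n0 n) as [Hle | Hgt].
  - replace n with (n0 + Z.of_nat (Z.to_nat (n - n0)))%Z by lia. now apply Hk.
  - replace n with (n0 - Z.of_nat (Z.to_nat (n0 - n)))%Z by lia. now apply Hk.
Qed.

(** The starting time 2 tau + 1 keeps t - tau beyond tau, where the growth bound
    is available. *)
Lemma mild_solution_logistic_supersolution (D tau d : R) g phi u :
  0 < D -> 0 <= tau -> H1 g -> H2 g -> admissible tau phi ->
  mild_solution D tau d g phi u ->
  exists A, 0 <= A /\ logistic_supersolution D (g 0 0) A (2 * tau + 1) u.
Proof.
  intros HD Htau Hg1 Hg2 Hphi Hu.
  assert (Hrange : forall k x, - tau <= x -> 0 <= u k x <= 1)
    by (intros; eapply mild_solution_range; eassumption).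
  destruct (mild_solution_mean_growth D tau d g phi u HD Htau Hg1 Hg2 Hphi Hu) as [b [_ Hb]].
  destruct (g_lipschitz_nonneg g Hg2) as [L [HL HgL]].
  exists (L * (1 + exp (b * tau))). split.
  { apply Rmult_le_pos; [exact HL|]. pose proof (exp_pos (b * tau)). lra. }
  intros n t Ht.
  eexists. split; [apply (mild_solution_ode D tau d g phi u n t); try assumption; lra|].
  apply Rplus_le_compat_l.
  pose proof (Hrange n t ltac:(lra)) as Hun. pose proof (Hrange n (t - tau) ltac:(lra)) as Hud.
  apply Rmult_le_compat_l; [lra|].
  eapply Rle_trans; [|apply (reaction_lower_bound g L HgL); assumption].
  assert (Hdelay : u n (t - tau) <= exp (b * tau) * u n t).
  { destruct (Hb n (t - tau) t ltac:(lra) ltac:(lra)) as [z [Hz Hle]].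
    assert (0 <= exp (b * (z - t)) * (D * (u (n + 1)%Z z + u (n - 1)%Z z)) * (t - (t - tau))).
    { pose proof (Hrange (n + 1)%Z z ltac:(lra)). pose proof (Hrange (n - 1)%Z z ltac:(lra)).
      repeat apply Rmult_le_pos; try lra. left; apply exp_pos. }
    replace (- b * (t - (t - tau))) with (- (b * tau)) in Hle by ring.
    apply Rmult_le_reg_l with (exp (- (b * tau))); [apply exp_pos|].
    rewrite <- Rmult_assoc, <- exp_plus, Rplus_opp_l, exp_0. lra. }
  assert (L * (u n t + u n (t - tau)) <= L * (u n t + exp (b * tau) * u n t))
    by (apply Rmult_le_compat_l; lra).
  lra.
Qed.

(** * Travelling humps *)

Lemma cos_ge_quadratic (x : R) : 0 < x -> 1 - x * x / 2 <= cos x.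
Proof.
  intros Hx. replace (cos x) with (cos (2 * (x / 2))) by (f_equal; field). rewrite cos_2a_sin.
  destruct (Rlt_le_dec x 2) as [Hx2 | Hx2].
  - pose proof (sin_lt_x (x / 2) ltac:(lra)).
    assert (0 < sin (x / 2)) by (apply sin_gt_0; pose proof PI2_3_2; unfold PI2 in *; lra).
    nra.
  - pose proof (SIN_bound (x / 2)). nra.
Qed.

Lemma sin_ge_half (x : R) : 0 < x <= 1 -> x / 2 <= sin x.
Proof.
  intros Hx.
  destruct (MVT_cor2 sin cos 0 x ltac:(lra)) as [y [Heq Hy]].
  { intros y _. apply derivable_pt_lim_sin. }
  rewrite sin_0 in Heq.
  pose proof (cos_ge_quadratic y ltac:(lra)). nra.
Qed.

(** Given omega, the first identity determines l from k through arcsinh.  The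
    margin Phi(l) - k l is bounded below by (c0 - c) l, and also by r - c l, which
    takes over when l is small; omega is then chosen so that replacing cosh(l) by
    cosh(l) cos(omega) costs at most half of this margin. *)
Lemma wave_parameters_nonneg (D r c0 c : R) :
  0 < D -> 0 < r -> 0 < c < c0 -> (forall l, 0 < l -> c0 * l <= dispersion D r l) ->
  exists delta omega Lam, 0 < delta /\ 0 < omega <= 1 /\ forall k, 0 <= k <= c ->
    exists l, 0 <= l <= Lam /\ k * omega = D * (exp l - exp (- l)) * sin omega /\
      delta <= D * ((exp l + exp (- l)) * cos omega - 2) + r - k * l.
Proof.
  intros HD Hr Hc Hc0.
  set (delta0 := Rmin (r / 2) ((c0 - c) * (r / (2 * c)))).
  assert (Hd0 : 0 < delta0).
  { apply Rmin_glb_lt; [lra|]. apply Rmult_lt_0_compat; [lra|]. apply Rdiv_lt_0_compat; lra. }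
  assert (Hgap : forall k l, 0 <= k <= c -> 0 <= l -> delta0 <= dispersion D r l - k * l).
  { intros k l Hk Hl. assert (Hkl : k * l <= c * l) by (apply Rmult_le_compat_r; lra).
    destruct (Rle_lt_dec l (r / (2 * c))) as [Hs | Hb].
    - pose proof (Rmin_l (r / 2) ((c0 - c) * (r / (2 * c)))) as Hm. fold delta0 in Hm.
      pose proof (dispersion_ge D r l HD Hl).
      assert (c * l <= c * (r / (2 * c))) by (apply Rmult_le_compat_l; lra).
      assert (c * (r / (2 * c)) = r / 2) by (field; lra). lra.
    - pose proof (Rmin_r (r / 2) ((c0 - c) * (r / (2 * c)))) as Hm. fold delta0 in Hm.
      assert (0 < r / (2 * c)) by (apply Rdiv_lt_0_compat; lra).
      pose proof (Hc0 l ltac:(lra)).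
      assert ((c0 - c) * (r / (2 * c)) <= (c0 - c) * l) by (apply Rmult_le_compat_l; lra).
      lra. }
  set (Lam := 2 * c / D).
  set (omega := Rmin 1 (delta0 / (2 * (D * exp Lam)))).
  assert (HDe : 0 < D * exp Lam) by (apply Rmult_lt_0_compat; [lra | apply exp_pos]).
  assert (Hom : 0 < omega <= 1).
  { split; [|apply Rmin_l]. apply Rmin_glb_lt; [lra|]. apply Rdiv_lt_0_compat; lra. }
  assert (HomD : D * exp Lam * omega <= delta0 / 2).
  { replace (delta0 / 2) with (D * exp Lam * (delta0 / (2 * (D * exp Lam)))) by (field; pose proof (exp_pos Lam); lra).
    apply Rmult_le_compat_l; [lra | apply Rmin_r]. }
  exists (delta0 / 2), omega, Lam. split; [lra|]. split; [exact Hom|].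
  intros k Hk. pose proof (sin_ge_half omega Hom) as Hsin.
  set (y := k * omega / (2 * D * sin omega)).
  assert (HDs : 0 < 2 * D * sin omega) by (apply Rmult_lt_0_compat; lra).
  assert (Hy : 0 <= y) by (apply Rdiv_le_0_compat; [apply Rmult_le_pos; lra | exact HDs]).
  set (l := arcsinh y).
  assert (Hl : 0 <= l) by (rewrite <- arcsinh_0; now apply arcsinh_le).
  assert (Hsinh : exp l - exp (- l) = 2 * y).
  { pose proof (sinh_arcsinh y) as Hs. fold l in Hs. unfold sinh in Hs. lra. }
  assert (Hly : l <= Lam).
  { eapply Rle_trans; [now apply exp_sub_exp_opp_ge|]. rewrite Hsinh.
    unfold Lam. apply (Rle_div_r (2 * y) (2 * c) D HD). unfold y.
    replace (2 * (k * omega / (2 * D * sin omega)) * D) with (k * omega / sin omega) by (field; lra).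
    apply (Rle_div_l (k * omega) (2 * c) (sin omega)); [lra|].
    assert (k * omega <= k * (2 * sin omega)) by (apply Rmult_le_compat_l; lra).
    assert (k * (2 * sin omega) <= c * (2 * sin omega)) by (apply Rmult_le_compat_r; lra).
    lra. }
  exists l. split; [lra|]. split.
  - rewrite Hsinh. unfold y. field. lra.
  - pose proof (Hgap k l Hk Hl) as Hg. unfold dispersion in Hg.
    assert (Hel : exp l <= exp Lam) by now apply exp_le.
    assert (exp (- l) <= exp l) by (apply exp_le; lra).
    pose proof (exp_pos l). pose proof (exp_pos (- l)).
    pose proof (cos_ge_quadratic omega ltac:(lra)) as Hcos.
    assert (omega * omega <= omega) by nra.
    assert ((exp l + exp (- l)) * (1 - cos omega) <= 2 * exp Lam * (omega / 2)).
    { pose proof (COS_bound omega). apply Rmult_le_compat; lra. }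
    assert (D * ((exp l + exp (- l)) * (1 - cos omega)) <= D * (2 * exp Lam * (omega / 2)))
      by (apply Rmult_le_compat_l; lra).
    lra.
Qed.

Lemma wave_parameters (D r c0 c : R) :
  0 < D -> 0 < r -> 0 < c < c0 -> (forall l, 0 < l -> c0 * l <= dispersion D r l) ->
  exists delta omega Lam, 0 < delta /\ 0 < omega <= 1 /\ forall k, Rabs k <= c ->
    exists l, Rabs l <= Lam /\ k * omega = D * (exp l - exp (- l)) * sin omega /\
      delta <= D * ((exp l + exp (- l)) * cos omega - 2) + r - k * l.
Proof.
  intros HD Hr Hc Hc0.
  destruct (wave_parameters_nonneg D r c0 c HD Hr Hc Hc0) as [delta [omega [Lam [Hd [Ho H]]]]].
  exists delta, omega, Lam. split; [exact Hd|]. split; [exact Ho|]. intros k Hk.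
  destruct (Rle_lt_dec 0 k) as [H0 | H0].
  - rewrite Rabs_pos_eq in Hk by exact H0.
    destruct (H k ltac:(lra)) as [l [Hl Hrest]].
    exists l. rewrite Rabs_pos_eq by lra. split; [lra | exact Hrest].
  - rewrite Rabs_left in Hk by exact H0.
    destruct (H (- k) ltac:(lra)) as [l [Hl [Heq Hle]]].
    exists (- l). rewrite Rabs_Ropp, Rabs_pos_eq, Ropp_involutive by lra.
    split; [lra|]. split; lra.
Qed.

(** Truncating the argument rather than the value writes the central arch of the
    cosine, extended by 0, as a composition of continuous functions. *)
Definition cos_hump (x : R) : R := cos (Rmax (- (PI / 2)) (Rmin (PI / 2) x)).

Lemma cos_hump_nonneg (x : R) : 0 <= cos_hump x.
Proof.
  pose proof PI_RGT_0. unfold cos_hump. apply cos_ge_0.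
  - apply Rmax_l.
  - apply Rmax_lub; [lra | apply Rmin_l].
Qed.

Lemma cos_hump_le_1 (x : R) : cos_hump x <= 1.
Proof. apply COS_bound. Qed.

Lemma cos_hump_inside (x : R) : Rabs x <= PI / 2 -> cos_hump x = cos x.
Proof.
  intros Hx. apply Rabs_le_between in Hx. unfold cos_hump.
  now rewrite Rmin_right, Rmax_right by (rewrite ?Rmin_right; lra).
Qed.

Lemma cos_hump_outside (x : R) : PI / 2 <= Rabs x -> cos_hump x = 0.
Proof.
  intros Hx. pose proof PI_RGT_0. unfold cos_hump.
  destruct (Rle_lt_dec 0 x) as [H0 | H0].
  - rewrite Rabs_pos_eq in Hx by exact H0.
    rewrite Rmin_left, Rmax_right by lra. apply cos_PI2.
  - rewrite Rabs_left in Hx by exact H0.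
    rewrite Rmin_right, Rmax_left by lra. rewrite cos_neg. apply cos_PI2.
Qed.

(** Beyond the central arch the cosine is nonpositive up to 3 pi / 2.  This leaves
    room for the neighbours of a site of the arch, so that there the untruncated
    wave can be used as a lower bound in the discrete Laplacian. *)
Lemma cos_le_cos_hump (x : R) : Rabs x <= 3 * (PI / 2) -> cos x <= cos_hump x.
Proof.
  intros Hx. destruct (Rle_lt_dec (Rabs x) (PI / 2)) as [H | H].
  - rewrite cos_hump_inside; lra.
  - rewrite cos_hump_outside by lra.
    destruct (Rle_lt_dec 0 x) as [H0 | H0].
    + rewrite Rabs_pos_eq in * by exact H0. apply cos_le_0; lra.
    + rewrite Rabs_left in * by exact H0. rewrite <- cos_neg. apply cos_le_0; lra.
Qed.

Lemma continuous_Rmax_const (a : R) (f : R -> R) (t : R) :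
  continuous f t -> continuous (fun s => Rmax a (f s)) t.
Proof.
  intros Hf. apply filterlim_locally. intros eps.
  generalize (proj1 (filterlim_locally f (f t)) Hf eps).
  apply filter_imp. intros s Hs. change (Rabs (f s - f t) < eps) in Hs.
  change (Rabs (Rmax a (f s) - Rmax a (f t)) < eps).
  eapply Rle_lt_trans; [|exact Hs].
  unfold Rmax, Rabs; repeat destruct Rle_dec; repeat destruct Rcase_abs; lra.
Qed.

Lemma continuous_Rmin (f h : R -> R) (t : R) :
  continuous f t -> continuous h t -> continuous (fun s => Rmin (f s) (h s)) t.
Proof.
  intros Hf Hh. apply filterlim_locally. intros eps.
  generalize (filter_and _ _ (proj1 (filterlim_locally f (f t)) Hf eps)
    (proj1 (filterlim_locally h (h t)) Hh eps)).
  apply filter_imp. intros s [Hs Hs']. change (Rabs (f s - f t) < eps) in Hs.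
  change (Rabs (h s - h t) < eps) in Hs'.
  change (Rabs (Rmin (f s) (h s) - Rmin (f t) (h t)) < eps).
  unfold Rmin, Rabs in *; repeat destruct Rle_dec; repeat destruct Rcase_abs; lra.
Qed.

Lemma continuous_cos_hump (x : R) : continuous cos_hump x.
Proof.
  apply (continuous_comp (fun x => Rmax (- (PI / 2)) (Rmin (PI / 2) x)) cos).
  - apply continuous_Rmax_const, continuous_Rmin; [apply continuous_const | apply continuous_id].
  - apply continuous_cos.
Qed.

(** * First contact *)

Fixpoint site_min (f : Z -> R) (N : nat) : R :=
  match N with
  | O => f 0%Z
  | S N' => Rmin (site_min f N') (Rmin (f (Z.of_nat N)) (f (- Z.of_nat N)%Z))
  end.

Lemma site_min_le (f : Z -> R) (N : nat) (n : Z) :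
  (Z.abs n <= Z.of_nat N)%Z -> site_min f N <= f n.
Proof.
  induction N as [| N IH]; intros Hn; simpl site_min.
  - replace n with 0%Z by lia. lra.
  - destruct (Z_le_gt_dec (Z.abs n) (Z.of_nat N)) as [H | H].
    + eapply Rle_trans; [apply Rmin_l | now apply IH].
    + eapply Rle_trans; [apply Rmin_r|].
      assert (Hc : n = Z.of_nat (S N) \/ n = (- Z.of_nat (S N))%Z) by lia.
      destruct Hc as [-> | ->]; [apply Rmin_l | apply Rmin_r].
Qed.

Lemma site_min_attained (f : Z -> R) (N : nat) :
  exists n, (Z.abs n <= Z.of_nat N)%Z /\ site_min f N = f n.
Proof.
  induction N as [| N [n [Hn IH]]]; simpl site_min.
  - now exists 0%Z.
  - unfold Rmin at 1. destruct Rle_dec.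
    + exists n. split; [lia | exact IH].
    + unfold Rmin. destruct Rle_dec; eexists; (split; [|reflexivity]); lia.
Qed.

Lemma continuous_site_min (f : Z -> R -> R) (N : nat) (t : R) :
  (forall n, continuous (f n) t) -> continuous (fun s => site_min (fun n => f n s) N) t.
Proof.
  intros Hf. induction N as [| N IH]; simpl site_min; [apply Hf|].
  apply continuous_Rmin; [exact IH|]. apply continuous_Rmin; apply Hf.
Qed.

Lemma locally_interval (P : R -> Prop) (t : R) :
  locally t P -> exists e, 0 < e /\ forall s, Rabs (s - t) < e -> P s.
Proof. intros [e He]. exists e. split; [apply cond_pos | exact He]. Qed.

Lemma first_zero (F : R -> R) (a b : R) :
  a <= b -> (forall t, a <= t <= b -> continuous F t) -> 0 < F a -> F b <= 0 ->
  exists t, a < t <= b /\ F t = 0 /\ forall s, a <= s < t -> 0 < F s.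
Proof.
  intros Hab HF Ha Hb.
  set (E := fun x => a <= x <= b /\ forall s, a <= s <= x -> 0 < F s).
  assert (HEa : E a) by (split; [lra|]; intros s Hs; replace s with a by lra; exact Ha).
  destruct (completeness E) as [t [Hub Hlub]].
  { exists b. intros x [Hx _]. lra. }
  { now exists a. }
  assert (Hat : a <= t) by now apply Hub.
  assert (Htb : t <= b) by (apply Hlub; intros x [Hx _]; lra).
  assert (Hbelow : forall s, a <= s < t -> 0 < F s).
  { intros s Hs. apply Rnot_le_lt. intros Hle.
    apply (Rlt_not_le t s); [lra|]. apply Hlub. intros x [Hx Hxs].
    apply Rnot_lt_le. intros Hlt. pose proof (Hxs s ltac:(lra)). lra. }
  specialize (HF t ltac:(lra)).
  destruct (Rtotal_order (F t) 0) as [Hneg | [Hzero | Hpos]].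
  - exfalso. destruct (locally_interval _ _ (HF _ (open_lt 0 (F t) Hneg))) as [e [He Hnear]].
    assert (a < t) by (destruct Hat as [Hat | <-]; [exact Hat | lra]).
    set (s := Rmax a (t - e / 2)).
    assert (Hs : a <= s < t) by (split; [apply Rmax_l | apply Rmax_lub_lt; lra]).
    pose proof (Rmax_r a (t - e / 2)) as Hs'. fold s in Hs'.
    pose proof (Hbelow s Hs). specialize (Hnear s ltac:(rewrite Rabs_left; lra)). lra.
  - exists t. split; [|easy]. split; [|exact Htb].
    destruct Hat as [Hat | <-]; [exact Hat | lra].
  - exfalso. destruct (locally_interval _ _ (HF _ (open_gt 0 (F t) Hpos))) as [e [He Hnear]].
    assert (t < b) by (destruct Htb as [Htb | ->]; [exact Htb | lra]).
    set (x := Rmin b (t + e / 2)).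
    assert (Hx : t < x <= b) by (split; [apply Rmin_glb_lt; lra | apply Rmin_l]).
    pose proof (Rmin_r b (t + e / 2)) as Hx'. fold x in Hx'.
    apply (Rlt_not_le x t); [lra|]. apply Hub. split; [lra|].
    intros s Hs. destruct (Rlt_le_dec s t) as [Hst | Hst]; [apply Hbelow; lra|].
    apply Hnear. rewrite Rabs_pos_eq; lra.
Qed.

Lemma derive_nonpos_at_first_zero (f : R -> R) (a t l : R) :
  is_derive f t l -> a < t -> f t = 0 -> (forall s, a <= s < t -> 0 < f s) -> l <= 0.
Proof.
  intros Hf Hat Hft Hpos. apply Rnot_lt_le. intros Hl.
  apply is_derive_Reals in Hf. destruct (Hf l Hl) as [e He].
  set (h := - Rmin (t - a) (e / 2)).
  assert (He0 : 0 < e) by apply cond_pos.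
  assert (Hh : - h <= t - a /\ - h <= e / 2 /\ h < 0).
  { unfold h. pose proof (Rmin_l (t - a) (e / 2)). pose proof (Rmin_r (t - a) (e / 2)).
    assert (0 < Rmin (t - a) (e / 2)) by (apply Rmin_glb_lt; lra). lra. }
  specialize (He h ltac:(lra) ltac:(rewrite Rabs_left; lra)).
  rewrite Hft, Rminus_0_r in He. apply Rabs_lt_between in He.
  assert (f (t + h) / h < 0).
  { unfold Rdiv.
    pose proof (Hpos (t + h) ltac:(lra)). pose proof (Rinv_lt_0_compat h ltac:(lra)). nra. }
  lra.
Qed.

(** * Spreading of logistic supersolutions *)

Definition wave (l omega eps x : R) : R := eps * (exp (- l * x) * cos (omega * x)).
Definition hump (l omega eps x : R) : R := eps * (exp (- l * x) * cos_hump (omega * x)).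

Lemma hump_continuous (l omega eps x : R) : continuous (hump l omega eps) x.
Proof.
  apply (@continuous_mult R_UniformSpace R_AbsRing); [apply continuous_const|].
  apply (@continuous_mult R_UniformSpace R_AbsRing).
  - apply (@ex_derive_continuous R_AbsRing R_NormedModule). auto_derive. easy.
  - apply (continuous_comp (fun x => omega * x) cos_hump); [|apply continuous_cos_hump].
    apply (@ex_derive_continuous R_AbsRing R_NormedModule). auto_derive. easy.
Qed.

Lemma wave_le_hump (l omega eps x : R) :
  0 <= eps -> Rabs (omega * x) <= 3 * (PI / 2) -> wave l omega eps x <= hump l omega eps x.
Proof.
  intros He Hx. unfold wave, hump. apply Rmult_le_compat_l; [exact He|].
  apply Rmult_le_compat_l; [left; apply exp_pos|]. now apply cos_le_cos_hump.
Qed.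

(** The discrete Laplacian acts on the wave through a cosine and a sine part; the
    latter is what the speed has to compensate. *)
Lemma wave_shift (l omega eps x : R) :
  wave l omega eps (x + 1) + wave l omega eps (x - 1) =
  eps * (exp (- l * x) * ((exp l + exp (- l)) * cos omega * cos (omega * x)
    + (exp l - exp (- l)) * sin omega * sin (omega * x))).
Proof.
  unfold wave.
  replace (- l * (x + 1)) with (- l * x + - l) by ring.
  replace (- l * (x - 1)) with (- l * x + l) by ring.
  replace (omega * (x + 1)) with (omega * x + omega) by ring.
  replace (omega * (x - 1)) with (omega * x - omega) by ring.
  rewrite !exp_plus, cos_plus, cos_minus. ring.
Qed.

Lemma hump_le (l omega eps x : R) :
  0 < omega -> 0 <= eps -> hump l omega eps x <= eps * exp (Rabs l * (PI / 2 / omega)).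
Proof.
  intros Ho He. unfold hump. apply Rmult_le_compat_l; [exact He|].
  destruct (Rle_lt_dec (PI / 2) (Rabs (omega * x))) as [H | H].
  - rewrite cos_hump_outside, Rmult_0_r by exact H. left. apply exp_pos.
  - rewrite <- (Rmult_1_r (exp (Rabs l * _))).
    apply Rmult_le_compat; [left; apply exp_pos | apply cos_hump_nonneg | | apply cos_hump_le_1].
    apply exp_le. eapply Rle_trans; [apply Rle_abs|].
    rewrite Rabs_mult, Rabs_Ropp. apply Rmult_le_compat_l; [apply Rabs_pos|].
    apply (Rle_div_r (Rabs x) (PI / 2) omega Ho).
    rewrite Rabs_mult, (Rabs_pos_eq omega) in H by lra. lra.
Qed.

(** First contact argument.  Up to a given time the hump has only visited finitely
    many sites, so the minimum of v - hump over those sites is a continuous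
    function and has a first zero t.  At the site m where it is attained v is
    positive, so the contact is in the interior of the hump and v - wave has
    nonpositive derivative there; but the wave is a strict subsolution, which makes
    this derivative positive. *)
Lemma hump_comparison (D r A T delta omega l k eps : R) (v : Z -> R -> R) :
  0 < D -> 0 <= A -> logistic_supersolution D r A T v ->
  (forall n t, T <= t -> 0 < v n t) ->
  0 < omega <= 1 -> 0 < eps ->
  k * omega = D * (exp l - exp (- l)) * sin omega ->
  delta <= D * ((exp l + exp (- l)) * cos omega - 2) + r - k * l ->
  A * (eps * exp (Rabs l * (PI / 2 / omega))) < delta ->
  (forall n, hump l omega eps (IZR n) < v n T) ->
  forall n t, T <= t -> hump l omega eps (IZR n - k * (t - T)) < v n t.
Proof.
  intros HD HA Hv Hvpos Hom Heps Hk Hdelta Hsmall Hinit n t1 Ht1.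
  pose proof PI_RGT_0 as HPI.
  set (x := fun (m : Z) s => IZR m - k * (s - T)).
  change (hump l omega eps (x n t1) < v n t1).
  apply Rnot_le_lt. intros Hbad.
  set (f := fun (m : Z) s => v m s - hump l omega eps (x m s)).
  (* The hump of half-width pi / (2 omega) has not left |j| <= N1 by time t1. *)
  destruct (INR_unbounded (Rabs k * (t1 - T) + PI / 2 / omega)) as [N1 HN1].
  set (N := (N1 + Z.to_nat (Z.abs n))%nat).
  set (F := fun s => site_min (fun m => f m s) N).
  assert (Hxc : forall m s, continuous (x m) s).
  { intros m s. apply (@ex_derive_continuous R_AbsRing R_NormedModule).
    unfold x. auto_derive. easy. }
  assert (Hfc : forall m s, T <= s -> continuous (f m) s).
  { intros m s Hs. destruct (Hv m s Hs) as [v' [Hv' _]].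
    apply (@continuous_minus R_UniformSpace R_AbsRing R_NormedModule).
    - apply (@ex_derive_continuous R_AbsRing R_NormedModule). now exists v'.
    - apply (continuous_comp (x m) (hump l omega eps)); [apply Hxc | apply hump_continuous]. }
  destruct (first_zero F T t1 Ht1) as [t [Ht [Hzero Hbefore]]].
  - intros s Hs. apply continuous_site_min. intros m. apply Hfc. lra.
  - unfold F. destruct (site_min_attained (fun m => f m T) N) as [m [_ ->]].
    unfold f, x. replace (IZR m - k * (T - T)) with (IZR m) by ring.
    specialize (Hinit m). lra.
  - eapply Rle_trans; [apply (site_min_le _ _ n); unfold N; lia|].
    unfold f. lra.
  - assert (Hnonneg : forall m, hump l omega eps (x m t) <= v m t).
    { intros m. destruct (Z_le_gt_dec (Z.abs m) (Z.of_nat N)) as [Hm | Hm].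
      - pose proof (site_min_le (fun m => f m t) N m Hm) as H. fold (F t) in H.
        rewrite Hzero in H. unfold f in H. lra.
      - unfold hump. rewrite cos_hump_outside.
        + rewrite !Rmult_0_r. left. apply Hvpos. lra.
        + rewrite Rabs_mult, (Rabs_pos_eq omega) by lra.
          assert (Hx : PI / 2 / omega <= Rabs (x m t)).
          { assert (Hm' : INR N1 <= Rabs (IZR m)).
            { rewrite INR_IZR_INZ, <- abs_IZR. apply IZR_le. unfold N in Hm. lia. }
            assert (Rabs (k * (t - T)) <= Rabs k * (t1 - T)).
            { rewrite Rabs_mult, (Rabs_pos_eq (t - T)) by lra.
              apply Rmult_le_compat_l; [apply Rabs_pos | lra]. }
            pose proof (Rabs_triang_inv (IZR m) (k * (t - T))). unfold x. lra. }
          apply (Rle_div_l (PI / 2) _ omega) in Hx; lra. }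
    destruct (site_min_attained (fun m => f m t) N) as [m [Hm Hmin]].
    fold (F t) in Hmin. rewrite Hzero in Hmin.
    assert (Hvm : v m t = hump l omega eps (x m t)) by (unfold f in Hmin; lra).
    pose proof (Hvpos m t ltac:(lra)) as Hvmpos.
    assert (Hin : Rabs (omega * x m t) < PI / 2).
    { apply Rnot_le_lt. intros Hle. unfold hump in Hvm.
      rewrite cos_hump_outside, !Rmult_0_r in Hvm by exact Hle. lra. }
    assert (Hwave : hump l omega eps (x m t) = wave l omega eps (x m t))
      by (unfold hump, wave; now rewrite cos_hump_inside by lra).
    destruct (Hv m t ltac:(lra)) as [v' [Hv' Hsuper]].
    set (w' := eps * (exp (- l * x m t) *
      (k * l * cos (omega * x m t) + k * omega * sin (omega * x m t)))).
    assert (Hf' : is_derive (f m) t (v' - w')).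
    { apply (is_derive_minus (K := R_AbsRing) (V := R_NormedModule)); [exact Hv'|].
      apply (is_derive_ext_loc (fun s => wave l omega eps (x m s))).
      - assert (Hc : continuous (fun s => Rabs (omega * x m s)) t).
        { apply (continuous_Rabs_comp (fun s => omega * x m s)).
          apply (@ex_derive_continuous R_AbsRing R_NormedModule). unfold x. auto_derive. easy. }
        assert (Hloc : locally t (fun s => Rabs (omega * x m s) < PI / 2))
          by exact (Hc _ (open_lt (PI / 2) _ Hin)).
        revert Hloc. apply filter_imp. intros s Hs.
        unfold hump, wave. rewrite cos_hump_inside; [reflexivity | lra].
      - unfold wave, x. auto_derive; [easy|]. unfold w', x, Rminus. ring. }
    assert (Hle : v' - w' <= 0).
    { apply (derive_nonpos_at_first_zero (f m) T t); [exact Hf' | lra | exact (eq_sym Hmin) |].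
      intros s Hs.
      eapply Rlt_le_trans; [apply Hbefore, Hs | exact (site_min_le (fun m => f m s) N m Hm)]. }
    apply (Rlt_not_le v' w'); [|lra].
    apply Rlt_le_trans with (2 := Hsuper).
    assert (Hside : forall y, Rabs (y - x m t) <= 1 -> wave l omega eps y <= hump l omega eps y).
    { intros y Hy. apply wave_le_hump; [lra|].
      replace (omega * y) with (omega * x m t + omega * (y - x m t)) by ring.
      eapply Rle_trans; [apply Rabs_triang|].
      rewrite (Rabs_mult omega (y - _)), (Rabs_pos_eq omega) by lra.
      assert (omega * Rabs (y - x m t) <= 1 * 1)
        by (apply Rmult_le_compat; try lra; apply Rabs_pos).
      pose proof PI2_3_2. unfold PI2 in *. lra. }
    assert (Hnb : wave l omega eps (x m t + 1) + wave l omega eps (x m t - 1)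
                  <= v (m + 1)%Z t + v (m - 1)%Z t).
    { pose proof (Hnonneg (m + 1)%Z) as Hr. pose proof (Hnonneg (m - 1)%Z) as Hl'.
      assert (E1 : x (m + 1)%Z t = x m t + 1) by (unfold x; rewrite plus_IZR; ring).
      assert (E2 : x (m - 1)%Z t = x m t - 1) by (unfold x; rewrite minus_IZR; ring).
      rewrite E1 in Hr. rewrite E2 in Hl'.
      pose proof (Hside (x m t + 1)
        ltac:(replace (x m t + 1 - x m t) with 1 by ring; rewrite Rabs_pos_eq; lra)).
      pose proof (Hside (x m t - 1)
        ltac:(replace (x m t - 1 - x m t) with (- 1) by ring; rewrite Rabs_left; lra)).
      lra. }
    rewrite wave_shift in Hnb. rewrite Hvm in Hvmpos |- *. rewrite Hwave in Hvmpos |- *.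
    assert (HAw : A * wave l omega eps (x m t) < delta).
    { eapply Rle_lt_trans; [|exact Hsmall]. apply Rmult_le_compat_l; [exact HA|].
      rewrite <- Hwave. apply hump_le; lra. }
    unfold wave in *. unfold w'.
    set (e := exp (- l * x m t)) in *. set (co := cos (omega * x m t)) in *.
    set (si := sin (omega * x m t)) in *.
    rewrite Hk.
    set (P := eps * (e * co)) in *.
    assert (D * (eps * (e * ((exp l + exp (- l)) * cos omega * co
      + (exp l - exp (- l)) * sin omega * si))) <= D * (v (m + 1)%Z t + v (m - 1)%Z t))
      by (apply Rmult_le_compat_l; lra).
    assert (0 < P * (D * ((exp l + exp (- l)) * cos omega - 2) + r - k * l - A * P))
      by (apply Rmult_lt_0_compat; lra).
    unfold P in *. nra.
Qed.

(** The height eps does not depend on the speed of the hump: at time T all the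
    humps live on the same finite set of sites and are bounded there by eps q,
    which is below the positive minimum of v on this set. *)
Lemma logistic_supersolution_spreads (D r A T c0 c : R) (v : Z -> R -> R) :
  0 < D -> 0 < r -> 0 <= A -> logistic_supersolution D r A T v ->
  (forall n t, T <= t -> 0 < v n t) ->
  (forall l, 0 < l -> c0 * l <= dispersion D r l) -> 0 < c < c0 ->
  exists eps, 0 < eps /\ forall n t, T <= t -> Rabs (IZR n) <= c * (t - T) -> eps <= v n t.
Proof.
  intros HD Hr HA Hv Hvpos Hc0 Hc. pose proof PI_RGT_0 as HPI.
  destruct (wave_parameters D r c0 c HD Hr Hc Hc0) as [delta [omega [Lam [Hdelta [Hom Hwave]]]]].
  destruct (INR_unbounded (PI / 2 / omega)) as [N HN].
  set (m := site_min (fun n => v n T) N).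
  assert (Hm : 0 < m).
  { unfold m. destruct (site_min_attained (fun n => v n T) N) as [n [_ ->]]. apply Hvpos. lra. }
  set (q := exp (Lam * (PI / 2 / omega))).
  assert (Hq : 0 < q) by apply exp_pos.
  set (eps := Rmin m (delta / (A + 1)) / (2 * q)).
  assert (Hmin : 0 < Rmin m (delta / (A + 1)))
    by (apply Rmin_glb_lt; [exact Hm | apply Rdiv_lt_0_compat; lra]).
  assert (Heps : 0 < eps) by (apply Rdiv_lt_0_compat; lra).
  assert (Heq : eps * q = Rmin m (delta / (A + 1)) / 2) by (unfold eps; field; lra).
  assert (Hepsm : eps * q < m).
  { pose proof (Rmin_l m (delta / (A + 1))). lra. }
  assert (HepsA : A * (eps * q) < delta).
  { pose proof (Rmin_r m (delta / (A + 1))).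
    assert (A * (eps * q) <= A * (delta / (A + 1) / 2)) by (apply Rmult_le_compat_l; lra).
    assert (A * (delta / (A + 1) / 2) < (A + 1) * (delta / (A + 1) / 2)).
    { apply Rmult_lt_compat_r; [|lra]. apply Rdiv_lt_0_compat; [|lra].
      apply Rdiv_lt_0_compat; lra. }
    assert ((A + 1) * (delta / (A + 1) / 2) = delta / 2) by (field; lra). lra. }
  exists eps. split; [exact Heps|]. intros n t Ht Hn.
  (* The hump that is centred at site n at time t. *)
  assert (Hk : exists k, Rabs k <= c /\ IZR n - k * (t - T) = 0).
  { destruct (Req_dec t T) as [-> | Hne].
    - exists 0. rewrite Rabs_R0. split; [lra|].
      rewrite Rminus_diag, Rmult_0_r in Hn.
      destruct (Req_dec (IZR n) 0) as [-> | H0]; [ring|].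
      pose proof (Rabs_pos_lt _ H0). lra.
    - exists (IZR n / (t - T)). split; [|field; lra].
      unfold Rdiv. rewrite Rabs_mult, Rabs_inv, (Rabs_pos_eq (t - T)) by lra.
      apply (Rle_div_l (Rabs (IZR n)) c (t - T)); lra. }
  destruct Hk as [k [Hkc Hcenter]].
  destruct (Hwave k Hkc) as [l [Hl [Hspeed Hgrowth]]].
  assert (Hel : exp (Rabs l * (PI / 2 / omega)) <= q).
  { apply exp_le. apply Rmult_le_compat_r; [|exact Hl].
    apply Rdiv_le_0_compat; lra. }
  assert (Hcmp : hump l omega eps (IZR n - k * (t - T)) < v n t).
  { apply (hump_comparison D r A T delta omega l k eps v); try assumption.
    - eapply Rle_lt_trans; [|exact HepsA]. apply Rmult_le_compat_l; [exact HA|].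
      apply Rmult_le_compat_l; lra.
    - intros j. destruct (Z_le_gt_dec (Z.abs j) (Z.of_nat N)) as [Hj | Hj].
      + apply Rlt_le_trans with m; [|now apply (site_min_le (fun n => v n T))].
        eapply Rle_lt_trans; [apply hump_le; lra|].
        eapply Rle_lt_trans; [|exact Hepsm]. apply Rmult_le_compat_l; lra.
      + unfold hump. rewrite cos_hump_outside.
        * rewrite !Rmult_0_r. apply Hvpos. lra.
        * rewrite Rabs_mult, (Rabs_pos_eq omega) by lra.
          assert (INR N <= Rabs (IZR j)).
          { rewrite INR_IZR_INZ, <- abs_IZR. apply IZR_le. lia. }
          rewrite Rmult_comm. apply (Rle_div_l (PI / 2) _ omega); lra. }
  rewrite Hcenter in Hcmp. unfold hump in Hcmp.
  rewrite !Rmult_0_r, exp_0 in Hcmp.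
  rewrite cos_hump_inside, cos_0 in Hcmp by (rewrite Rabs_R0; lra). lra.
Qed.

(** * The spreading speed *)

Lemma tends_to_exp_decay (f : R -> Rbar) (K eta : R) :
  0 < eta ->
  (forall t, 0 < t -> exists x, f t = Finite x /\ 0 <= x <= K * exp (- eta * t)) ->
  tends_to f 0.
Proof.
  intros Heta Hf. split.
  - exists 0. intros t Ht. destruct (Hf t Ht) as [x [-> _]]. reflexivity.
  - apply (is_lim_le_le_loc (fun _ => 0) (fun t => K * exp (- eta * t))).
    + exists 0. intros t Ht. destruct (Hf t Ht) as [x [-> Hx]]. exact Hx.
    + apply is_lim_const.
    + replace (Finite 0) with (Rbar_mult K 0) by (simpl; f_equal; ring).
      apply (is_lim_scal_l (fun t => exp (- eta * t)) K p_infty 0).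
      apply (is_lim_comp exp (fun t => - eta * t) p_infty 0 m_infty); [apply is_lim_exp_m | |].
      * replace m_infty with (Rbar_mult (Finite (- eta)) p_infty).
        -- apply (is_lim_scal_l (fun t => t) (- eta) p_infty p_infty), is_lim_id.
        -- simpl. destruct Rle_dec; [exfalso; lra | reflexivity].
      * now exists 0.
Qed.

Lemma liminf_infty_pos (f : R -> Rbar) (T eps : R) :
  0 < eps -> (forall t, T < t -> Rbar_le eps (f t)) -> Rbar_lt 0 (liminf_infty f).
Proof.
  intros Heps Hf. unfold liminf_infty.
  set (G := Rbar_glb (fun y => exists t, T < t /\ y = f t)).
  apply Rbar_lt_le_trans with (Finite eps); [exact Heps|].
  apply Rbar_le_trans with G.
  - apply (proj2 (proj2_sig (Rbar_ex_glb _))).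
    intros y [t [Ht ->]]. now apply Hf.
  - apply (proj1 (proj2_sig (Rbar_ex_lub _))). now exists T.
Qed.

Theorem theorem2p6 (D tau d : R) (g : R -> R -> R) (phi u : Z -> R -> R)
    (hD : 0 < D) (htau : 0 <= tau)
    (hg1 : H1 g) (hg2 : H2 g) (hg3 : H3 g)
    (hd : monotonizing g d)
    (hphi : admissible tau phi)
    (hsupp : exists M : R, 0 < M /\
       forall (n : Z) (s : R), M < Rabs (IZR n) -> - tau <= s <= 0 -> phi n s = 0)
    (hpos : exists n : Z, 0 < phi n 0)
    (hu : mild_solution D tau d g phi u) :
  is_spreading_speed u (c_star D g).
Proof.
  pose proof (g00_pos g hg1 hg2) as Hr.
  assert (Hrange : forall k x, - tau <= x -> 0 <= u k x <= 1)
    by (intros; eapply mild_solution_range; eassumption).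
  split; [now apply c_star_pos|]. split.
  - intros c Hc. destruct hsupp as [M [HM Hsupp]].
    destruct (c_star_lt_dispersion D g c hD Hr Hc) as [l [Hl Hlc]].
    apply (tends_to_exp_decay _ (exp (l * M)) (c * l - dispersion D (g 0 0) l)); [lra|].
    intros t Ht.
    assert (Hbound : forall n, c * t < Rabs (IZR n) ->
      u n t <= exp (l * M) * exp (- (c * l - dispersion D (g 0 0) l) * t)).
    { intros n Hn.
      (* The exponential decays towards the side on which n lies. *)
      assert (Hsign : exists l', Rabs l' = l /\ l' * IZR n = l * Rabs (IZR n) /\
        dispersion D (g 0 0) l' = dispersion D (g 0 0) l).
      { destruct (Rle_lt_dec 0 (IZR n)) as [H0 | H0].
        - exists l. rewrite !Rabs_pos_eq by lra. easy.
        - exists (- l). rewrite Rabs_Ropp, Rabs_pos_eq, Rabs_left, dispersion_opp by lra.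
          split; [reflexivity|]. split; [ring | reflexivity]. }
      destruct Hsign as [l' [Habs [Hl' Hdisp]]].
      eapply Rle_trans.
      - apply (exponential_upper_bound D tau d g phi u M l'); try assumption; try lra.
        apply hd.
      - rewrite Habs, Hdisp, Rmult_assoc, <- exp_plus.
        apply Rmult_le_compat_l; [left; apply exp_pos|]. apply exp_le.
        assert (l * (c * t) < l * Rabs (IZR n)) by now apply Rmult_lt_compat_l.
        lra. }
    unfold outer_sup.
    set (S := fun y => exists n, c * t < Rabs (IZR n) /\ y = u n t).
    pose proof (Lub_Rbar_correct S) as [Hub Hlub].
    assert (Hle : Rbar_le (Lub_Rbar S)
      (exp (l * M) * exp (- (c * l - dispersion D (g 0 0) l) * t))).
    { apply Hlub. intros y [n [Hn ->]]. now apply Hbound. }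
    assert (Hge : Rbar_le 0 (Lub_Rbar S)).
    { destruct (INR_unbounded (c * t)) as [N HN].
      apply Rbar_le_trans with (u (Z.of_nat N) t); [apply Hrange; lra|].
      apply Hub. exists (Z.of_nat N). split; [|reflexivity].
      rewrite <- INR_IZR_INZ, Rabs_pos_eq by apply pos_INR. exact HN. }
    destruct (Lub_Rbar S) as [x | |]; [|easy|easy].
    exists x. split; [reflexivity | split; assumption].
  - intros c Hc.
    destruct (mild_solution_logistic_supersolution D tau d g phi u hD htau hg1 hg2 hphi hu)
      as [A [HA Hsuper]].
    set (T := 2 * tau + 1) in *.
    (* A speed between c and c_star absorbs the delay T at which the comparison
       starts: c t <= c' (t - T) for large t. *)
    set (c' := (c + c_star D g) / 2).
    destruct (logistic_supersolution_spreads D (g 0 0) A T (c_star D g) c' u hD Hr HA Hsuper)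
      as [eps [Heps Hspread]].
    + intros n t Ht. apply (mild_solution_pos D tau d g phi u); try assumption. unfold T in Ht; lra.
    + intros l Hl. now apply c_star_le_dispersion.
    + unfold c'. lra.
    + apply (liminf_infty_pos _ (c' * T / (c' - c)) eps Heps).
      intros t Ht. unfold inner_inf.
      apply Glb_Rbar_correct. intros y [n [Hn ->]]. simpl.
      assert (Hcc : 0 < c' - c) by (unfold c'; lra).
      apply Rlt_div_l in Ht; [|exact Hcc].
      assert (HT : 0 < T) by (unfold T; lra).
      assert (T <= t).
      { assert (c' * T < c' * t).
        { assert (0 < t) by nra. nra. }
        apply Rlt_le, (Rmult_lt_reg_l c'); [unfold c'; lra | assumption]. }
      apply Hspread; [assumption | lra].
Qed.
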